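(* Let $m\ge n\ge 3$, $p\le n-3$ and $q\le m-3$ be integers with $m-q\ge n-p$. Then $$\gamma_c(G(n,m)) = \begin{cases} \gamma_c(G(n-p,m-q)) + \left\lceil \dfrac q2\right\rceil, & \text{if } m \text{ is even and } q \text{ is odd},\\[8pt] \gamma_c(G(n-p,m-q)) + \left\lfloor \dfrac q2\right\rfloor, & \text{otherwise}.\end{cases}$$
   Context: For integers $n,m\ge 1$, the grid $G(n,m)$ has cell set $V_{n,m}=\{(i,j): 1\le i\le n,\ 1\le j\le m\}$ ($i$ = row, $j$ = column). Contamination rules: a cell $u=(i,j)\in V_{n,m}$ can be contaminated by two contaminated cells $v,w\in V_{n,m}$ if one of the following holds: (a) $v=(i-1,j-1)$, $w=(i+1,j+1)$; (b) $v=(i+1,j-1)$, $w=(i-1,j+1)$; (c) $v=(i-1,j)$, $w=(i+1,j)$; (d) $v=(i,j-1)$, $w=(i,j+1)$; (e) $v=(i,j-1)$, $w=(i-1,j)$; (f) $v=(i,j-1)$, $w=(i+1,j)$; (g) $v=(i+1,j)$, $w=(i,j+1)$; (h) $v=(i-1,j)$, $w=(i,j+1)$. For $S\subseteq V_{n,m}$, the final contaminated set $C(S)$ is the smallest subset of $V_{n,m}$ containing $S$ and closed under rules (a)--(h). $S$ is a contaminating set if $C(S)=V_{n,m}$. The power contamination number $\gamma_c(G(n,m))$ is the minimum cardinality of a contaminating set. *)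

(* Defs.v *)
From mathcomp Require Import all_boot all_order all_algebra.
Set Implicit Arguments.
Unset Strict Implicit.
Unset Printing Implicit Defensive.
Import Order.TTheory GRing.Theory Num.Theory.
Local Open Scope ring_scope.

(* Rows and columns are numbered from 0 here; the rules are invariant under   *)
(* this shift.                                                                *)
Definition cell (n m : nat) : finType := ('I_n * 'I_m)%type.

(* v is the cell of the grid at position u + (a, b); offsets are integers, so *)
(* that there is no such v when the position falls outside the grid.          *)
Definition at_offset (n m : nat) (u : cell n m) (a b : int) (v : cell n m)
    : bool :=
  ((v.1 : nat)%:Z == (u.1 : nat)%:Z + a) &&
  ((v.2 : nat)%:Z == (u.2 : nat)%:Z + b).

Definition can_contaminate (n m : nat) (v w u : cell n m) : bool :=
  [|| at_offset u (-1) (-1) v && at_offset u 1 1 w,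
      at_offset u 1 (-1) v && at_offset u (-1) 1 w,
      at_offset u (-1) 0 v && at_offset u 1 0 w,
      at_offset u 0 (-1) v && at_offset u 0 1 w,
      at_offset u 0 (-1) v && at_offset u (-1) 0 w,
      at_offset u 0 (-1) v && at_offset u 1 0 w,
      at_offset u 1 0 v && at_offset u 0 1 w
    | at_offset u (-1) 0 v && at_offset u 0 1 w].

Definition contamination_closed (n m : nat) (T : {set cell n m}) : bool :=
  [forall v in T, forall w in T, forall u, can_contaminate v w u ==> (u \in T)].

Definition final_contaminated (n m : nat) (S : {set cell n m})
    : {set cell n m} :=
  \bigcap_(T : {set cell n m} | (S \subset T) && contamination_closed T) T.

Definition contaminating (n m : nat) (S : {set cell n m}) : bool :=
  final_contaminated S == [set: cell n m].

(* The whole grid is contaminating, so the minimum is over a nonempty family. *)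
Definition power_contamination_number (n m : nat) : nat :=
  #|[arg min_(S < [set: cell n m] | contaminating S) #|S|]|.

(* Main.v *)
Require Import Defs.
From mathcomp Require Import all_boot all_order all_algebra.
From mathcomp Require Import zify lra.
Set Implicit Arguments.
Unset Strict Implicit.
Unset Printing Implicit Defensive.
Import Order.TTheory GRing.Theory Num.Theory.
Local Open Scope ring_scope.

(** For [3 <= n <= m] one has [gamma_c(G(n,m)) = floor(m/2) + 1], from which
    the recurrence is arithmetic.  Lower bound: no cell of an empty column can
    be contaminated before both neighbouring columns are occupied, so two
    consecutive empty columns, or an empty first or last column, stay empty
    forever; the blocks {0}, {1,2}, {3,4}, ... of columns must each meet a
    contaminating set.  Upper bound: the cells (min(2k,n-1), min(2k,m-1)),
    for k <= m/2, successively enlarge a full rectangle at the corner. *)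

(** * Growth of a full corner rectangle under the contamination rules *)

Section FullRectangle.

Variable P : nat -> nat -> Prop.

(** [P] lives on pairs of naturals, so that moving between positions needs no bound proofs; it will
    be membership in a closed set. *)
Definition full_rectangle (a b : nat) : Prop :=
  forall i j, (i < a)%N -> (j < b)%N -> P i j.

Variables n m : nat.

Hypothesis close_left_up : forall i j, (i.+1 < n)%N -> (j.+1 < m)%N ->
  P i.+1 j -> P i j.+1 -> P i.+1 j.+1.
Hypothesis close_left_down : forall i j, (i.+1 < n)%N -> (j.+1 < m)%N ->
  P i j -> P i.+1 j.+1 -> P i j.+1.
Hypothesis close_up_right : forall i j, (i.+1 < n)%N -> (j.+1 < m)%N ->
  P i j -> P i.+1 j.+1 -> P i.+1 j.
Hypothesis close_diagonal : forall i j, (i.+2 < n)%N -> (j.+2 < m)%N ->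
  P i j -> P i.+2 j.+2 -> P i.+1 j.+1.
Hypothesis close_row : forall i j, (i < n)%N -> (j.+2 < m)%N ->
  P i j -> P i j.+2 -> P i j.+1.

(** The new column fills outwards from row [i]: each further cell has its left neighbour in the
    rectangle and its upper or lower neighbour already filled. *)
Lemma full_rectangle_add_col a b i : (a <= n)%N -> (0 < b < m)%N -> (i < a)%N ->
  full_rectangle a b -> P i b -> full_rectangle a b.+1.
Proof.
case: b => // b an bm ia full_ab Pib.
have down k : (i + k < a)%N -> P (i + k)%N b.+1.
  elim: k => [|k IHk] lt_a; first by rewrite addn0.
  rewrite addnS; apply: close_left_up; [lia | lia | apply: full_ab; lia |].
  by apply: IHk; lia.
have up k : (k <= i)%N -> P (i - k)%N b.+1.
  elim: k => [|k IHk] le_i; first by rewrite subn0.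
  apply: close_left_down; [lia | lia | apply: full_ab; lia |].
  by have -> : (i - k.+1).+1 = (i - k)%N by [lia]; apply: IHk; lia.
move=> x y xa; rewrite ltnS leq_eqVlt => /orP[/eqP-> | yb]; last exact: full_ab.
have [le_ix|lt_xi] := leqP i x.
  by rewrite -(subnKC le_ix); apply: down; lia.
by rewrite -(subKn (ltnW lt_xi)); apply: up; lia.
Qed.

Lemma full_rectangle_add_row a b j : (0 < a < n)%N -> (b <= m)%N -> (j < b)%N ->
  full_rectangle a b -> P a j -> full_rectangle a.+1 b.
Proof.
case: a => // a an bm jb full_ab Paj.
have right k : (j + k < b)%N -> P a.+1 (j + k)%N.
  elim: k => [|k IHk] lt_b; first by rewrite addn0.
  rewrite addnS; apply: close_left_up; [lia | lia | | apply: full_ab; lia].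
  by apply: IHk; lia.
have left k : (k <= j)%N -> P a.+1 (j - k)%N.
  elim: k => [|k IHk] le_j; first by rewrite subn0.
  apply: close_up_right; [lia | lia | apply: full_ab; lia |].
  by have -> : (j - k.+1).+1 = (j - k)%N by [lia]; apply: IHk; lia.
move=> x y; rewrite ltnS leq_eqVlt => /orP[/eqP-> | xa] yb; last exact: full_ab.
have [le_jy|lt_yj] := leqP j y.
  by rewrite -(subnKC le_jy); apply: right; lia.
by rewrite -(subKn (ltnW lt_yj)); apply: left; lia.
Qed.

Lemma full_rectangle_add_corner a b : (0 < a < n)%N -> (0 < b < m)%N ->
  full_rectangle a b -> P a b -> full_rectangle a.+1 b.+1.
Proof.
move=> an bm full_ab Pab.
apply: (full_rectangle_add_row (j := b)) => //; [lia |].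
apply: (full_rectangle_add_col (i := a.-1)) => //; [lia | lia |].
case: a b an bm full_ab Pab => // a [//|b] an bm full_ab Pab.
(* The corner of the rectangle and the cell diagonally beyond it contaminate the cell between them
   in the new column; that column then fills, and [P a b] starts the new row. *)
by apply: close_left_down Pab; [lia | lia | apply: full_ab].
Qed.

Hypotheses (n_ge3 : (3 <= n)%N) (le_nm : (n <= m)%N).

Hypothesis seed : forall k, (k <= m./2)%N -> P (minn k.*2 n.-1) (minn k.*2 m.-1).

Lemma full_rectangle_seed k : (k <= m./2)%N ->
  full_rectangle (minn k.*2.+1 n) (minn k.*2.+1 m).
Proof.
elim: k => [_|k IHk lt_k].
  move=> i j i0 j0; have [-> ->] : i = 0%N /\ j = 0%N by lia.
  by have := @seed 0%N isT; rewrite /= !min0n.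
have {IHk} := IHk (ltnW lt_k); have := seed lt_k; rewrite doubleS.
have -> : minn k.*2.+1 m = k.*2.+1 by lia.
(* If this fails, then m = 2k+2 and the last seed is clipped to the column adjacent to the
   rectangle. *)
have [lt_m|ge_m] := ltnP k.*2.+2 m; last first.
  have -> : minn k.*2.+2 m.-1 = k.*2.+1 by lia.
  have -> : minn k.*2.+3 m = k.*2.+2 by lia.
  have [lt_n|ge_n] := ltnP k.*2.+1 n.
    have -> : minn k.*2.+2 n.-1 = k.*2.+1 by lia.
    have -> : minn k.*2.+3 n = k.*2.+2 by lia.
    by move=> Pc full; apply: full_rectangle_add_corner => //; lia.
  have -> : minn k.*2.+2 n.-1 = n.-1 by lia.
  have -> : minn k.*2.+3 n = n by lia.
  by move=> Pc full; apply: (full_rectangle_add_col (i := n.-1)) => //; lia.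
have -> : minn k.*2.+2 m.-1 = k.*2.+2 by lia.
have -> : minn k.*2.+3 m = k.*2.+3 by lia.
have [lt_n|ge_n] := ltnP k.*2.+2 n.
  have -> : minn k.*2.+2 n.-1 = k.*2.+2 by lia.
  have -> : minn k.*2.+3 n = k.*2.+3 by lia.
  have -> : minn k.*2.+1 n = k.*2.+1 by lia.
  move=> Pc full; apply: full_rectangle_add_corner => //.
  apply: full_rectangle_add_corner => //; [lia | lia |].
  (* The seed lies two diagonal steps beyond the corner; the diagonal rule fills the gap. *)
  by apply: close_diagonal => //; apply: full.
have -> : minn k.*2.+2 n.-1 = n.-1 by lia.
have -> : minn k.*2.+3 n = n by lia.
have [lt_n|{}ge_n] := ltnP k.*2.+1 n.
  have n_eq : n = k.*2.+2 by lia.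
  (* The seed is (2k+1, 2k+2), and its diagonal partner (2k-1, 2k) exists only for k > 0; k = 0
     would give n = 2. *)
  rewrite n_eq /=; case: k n_eq lt_k lt_m lt_n ge_n => [|k] n_eq lt_k lt_m lt_n ge_n.
    by lia.
  move=> Pc full; apply: full_rectangle_add_corner => //.
  apply: (full_rectangle_add_col (i := k.+1.*2)) => //; [lia | lia |].
  rewrite doubleS in Pc full lt_n lt_m *.
  by apply: close_diagonal => //; apply: full; lia.
move=> Pc full; apply: (full_rectangle_add_col (i := n.-1)) => //; [lia |].
apply: (full_rectangle_add_col (i := n.-1)) => //; [lia | lia |].
(* All rows are full, so the seed is two columns away in the last row. *)
by apply: close_row => //; [lia | apply: full; lia].
Qed.

Lemma full_rectangle_grid : full_rectangle n m.
Proof.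
have := full_rectangle_seed (leqnn m./2).
have -> : minn m./2.*2.+1 n = n by lia.
by have -> : minn m./2.*2.+1 m = m by lia.
Qed.

End FullRectangle.

(** * Lower and upper bounds for contaminating sets *)

Section Grid.

Variables n m : nat.
Implicit Types (S T : {set cell n m}) (u v w : cell n m).

Lemma contamination_closedP T :
  reflect (forall v w u, v \in T -> w \in T -> can_contaminate v w u -> u \in T)
          (contamination_closed T).
Proof.
apply: (iffP idP) => [clT v w u vT wT vwu | clT].
  by have /forall_inP/(_ v vT)/forall_inP/(_ w wT)/forallP/(_ u)/implyP := clT; apply.
apply/forall_inP => v vT; apply/forall_inP => w wT; apply/forallP => u.
by apply/implyP; apply: clT vT wT.
Qed.

Lemma subset_final_contaminated S T :
  S \subset T -> contamination_closed T -> final_contaminated S \subset T.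
Proof. by move=> ST clT; apply: bigcap_inf; rewrite ST clT. Qed.

Lemma contaminatingP S :
  reflect (forall T, S \subset T -> contamination_closed T -> T = setT)
          (contaminating S).
Proof.
apply: (iffP eqP) => [finS T ST clT | allT].
  by apply/eqP; rewrite eqEsubset subsetT -finS subset_final_contaminated.
by apply: big1 => T /andP[ST clT]; apply: allT.
Qed.

Lemma power_contamination_number_eq k :
    (forall S, contaminating S -> (k <= #|S|)%N) ->
    (exists2 S : {set cell n m}, contaminating S & (#|S| <= k)%N) ->
  power_contamination_number n m = k.
Proof.
move=> lowk [S0 conS0 cardS0]; rewrite /power_contamination_number.
case: arg_minnP => [|S conS minS].
  by apply/contaminatingP => T; rewrite subTset => /eqP.
by apply/eqP; rewrite eqn_leq lowk // (leq_trans (minS _ conS0)).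
Qed.

(** Block [k] consists of the columns 2k-1 and 2k inside the grid. Every rule uses a cell in the
    column of [u] or cells in both adjacent columns, and for [u] in the block one adjacent column is
    in the block or off the grid. *)
Lemma contamination_closed_out_block k :
  contamination_closed [set u : cell n m | uphalf u.2 != k].
Proof.
apply/contamination_closedP => -[[v1 ?] [v2 ?]] [[w1 ?] [w2 ?]] [[u1 ?] [u2 ?]].
rewrite !inE /can_contaminate /at_offset /=; lia.
Qed.

Lemma contaminating_card_ge S :
  (0 < n)%N -> (0 < m)%N -> contaminating S -> (m./2.+1 <= #|S|)%N.
Proof.
move=> n_gt0 m_gt0 /contaminatingP conS.
pose block u : 'I_m./2.+1 := inord (uphalf u.2).
suff -> : m./2.+1 = #|block @: S| by apply: leq_imset_card.
rewrite -[LHS]card_ord; apply: eq_card => k; rewrite inE; apply/esym.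
apply/negPn/negP => kS; have lt_k := ltn_ord k.
(* This column witnesses that block [k] is nonempty; the minimum matters only when m = 2k, where the
   last block is the single column 2k-1. *)
have lt_c : (minn k.*2 m.-1 < m)%N by lia.
have := contamination_closed_out_block k; move/conS => /(_ _)/setP.
have S_out : S \subset [set u : cell n m | uphalf u.2 != k].
  apply/subsetP => u uS; rewrite inE; apply: contra kS => /eqP uk.
  by apply/imsetP; exists u => //; apply: val_inj; rewrite /= inordK ?uk.
by move=> /(_ S_out (Ordinal n_gt0, Ordinal lt_c)); rewrite !inE /=; lia.
Qed.

Lemma contaminating_seed : (3 <= n)%N -> (n <= m)%N ->
  exists2 S : {set cell n m}, contaminating S & (#|S| <= m./2.+1)%N.
Proof.
move=> n_ge3 le_nm.
have seed1 k : (minn k n.-1 < n)%N by lia.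
have seed2 k : (minn k m.-1 < m)%N by lia.
pose seed (k : 'I_m./2.+1) : cell n m :=
  (Ordinal (seed1 k.*2), Ordinal (seed2 k.*2)).
exists (seed @: setT); last first.
  by rewrite (leq_trans (leq_imset_card _ _)) // cardsT card_ord.
apply/contaminatingP => T /subsetP seedT /contamination_closedP clT.
pose P i j := exists2 u, u \in T & (u.1 : nat) = i /\ (u.2 : nat) = j.
suff full : full_rectangle P n m.
  apply/setP => -[i j]; rewrite inE.
  have [[i' j'] uT [/= /val_inj eq_i /val_inj eq_j]] := full i j (ltn_ord i) (ltn_ord j).
  by rewrite -eq_i -eq_j.
(* Transfers a rule checked on coordinates to [P], so that each closure hypothesis reduces to linear
   arithmetic. *)
have step i j i1 j1 i2 j2 : (i < n)%N -> (j < m)%N ->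
    (forall u v w, (u.1 : nat) = i -> (u.2 : nat) = j ->
       (v.1 : nat) = i1 -> (v.2 : nat) = j1 ->
       (w.1 : nat) = i2 -> (w.2 : nat) = j2 -> can_contaminate v w u) ->
    P i1 j1 -> P i2 j2 -> P i j.
  move=> lt_i lt_j rule [v vT [v1 v2]] [w wT [w1 w2]].
  exists (Ordinal lt_i, Ordinal lt_j) => //.
  by apply: (clT v w) => //; apply: rule.
apply: full_rectangle_grid => //.
- move=> i j lt_i lt_j; apply: step => // u v w u1 u2 v1 v2 w1 w2.
  by rewrite /can_contaminate /at_offset u1 u2 v1 v2 w1 w2; lia.
- move=> i j lt_i lt_j; apply: step => [||u v w u1 u2 v1 v2 w1 w2]; [lia | lia |].
  by rewrite /can_contaminate /at_offset u1 u2 v1 v2 w1 w2; lia.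
- move=> i j lt_i lt_j; apply: step => [||u v w u1 u2 v1 v2 w1 w2]; [lia | lia |].
  by rewrite /can_contaminate /at_offset u1 u2 v1 v2 w1 w2; lia.
- move=> i j lt_i lt_j; apply: step => [||u v w u1 u2 v1 v2 w1 w2]; [lia | lia |].
  by rewrite /can_contaminate /at_offset u1 u2 v1 v2 w1 w2; lia.
- move=> i j lt_i lt_j; apply: step => [||u v w u1 u2 v1 v2 w1 w2]; [lia | lia |].
  by rewrite /can_contaminate /at_offset u1 u2 v1 v2 w1 w2; lia.
move=> k le_k; exists (seed (inord k)); first by apply/seedT/imset_f.
by rewrite /= inordK.
Qed.

Lemma power_contamination_numberE : (3 <= n)%N -> (n <= m)%N ->
  power_contamination_number n m = m./2.+1.
Proof.
move=> n_ge3 le_nm; apply: power_contamination_number_eq; last exact: contaminating_seed.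
by move=> S; apply: contaminating_card_ge; lia.
Qed.

End Grid.

(** * The recurrence as arithmetic of halves *)

Theorem corollary4 (n m : nat) (p q : int)
    (hn : (3 <= n)%N) (hnm : (n <= m)%N)
    (hp : p <= n%:Z - 3) (hq : q <= m%:Z - 3)
    (hpq : n%:Z - p <= m%:Z - q) :
  (power_contamination_number n m)%:Z =
    if ~~ odd m && odd `|q|%N then
      (power_contamination_number `|(n%:Z - p)%R|%N `|(m%:Z - q)%R|%N)%:Z
        + Num.ceil (q%:Q / 2)
    else
      (power_contamination_number `|(n%:Z - p)%R|%N `|(m%:Z - q)%R|%N)%:Z
        + Num.floor (q%:Q / 2).
Proof.
have n'_ge3 : (3 <= `|(n%:Z - p)%R|)%N by lia.
have le_n'm' : (`|(n%:Z - p)%R| <= `|(m%:Z - q)%R|)%N by lia.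
rewrite !power_contamination_numberE //.
set m' := `|(m%:Z - q)%R|%N; have m'E : m'%:Z = m%:Z - q by lia.
have [d dE] : exists d : int, d = (m./2)%:Z - (m'./2)%:Z by eexists.
(* It remains to see that the rounded q/2 equals [d]: parity gives q = 2d-1 in the ceiling case, and
   q = 2d or q = 2d+1 in the floor case. *)
have eq_d e : e = d -> (m./2.+1)%:Z = (m'./2.+1)%:Z + e by lia.
case: ifP => parity; apply: eq_d.
  have -> : q = 2 * d - 1 by lia.
  by apply: ceil_def; rewrite !rmorphB !rmorphM /=; lra.
have [-> | ->] : q = 2 * d \/ q = 2 * d + 1 by lia.
  by apply: floor_def; rewrite !rmorphD !rmorphM /=; lra.
by apply: floor_def; rewrite !rmorphD !rmorphM /=; lra.
Qed.
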